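(* Let $q\in(0,1)$, let $j_1,j_2\in\{0,\tfrac12,1,\tfrac32,\dots\}$, $j\in\{|j_1-j_2|,|j_1-j_2|+1,\dots,j_1+j_2\}$, $m_i\in\{-j_i,-j_i+1,\dots,j_i\}$ for $i=1,2$, and assume $m:=m_1+m_2$ satisfies $-j\le m\le j$. Then the Clebsch-Gordan coefficients of $su_q(2)$ satisfy $$\langle j_1m_1,j_2m_2|jm\rangle_q=(-1)^{j_2+m_2}\,q^{-m_2}\,\sqrt{\frac{[2j+1]_q}{[2j_1+1]_q}}\;\langle j\,{-m},j_2m_2|j_1\,{-m_1}\rangle_{1/q}.$$
   Context: Notation. For real $q>0$, $q\ne1$: $[x]_q=\frac{q^x-q^{-x}}{q-q^{-1}}$ for $x\in\mathbb R$; $[0]_q!=1$ and $[n]_q!=[1]_q[2]_q\cdots[n]_q$ for $n\in\mathbb N$. Representations. For $j\in\{0,\frac12,1,\dots\}$, $D^j$ is the complex inner product space with orthonormal basis $|jm\rangle$, $m=-j,-j+1,\dots,j$, and operators $$J_0|jm\rangle=m|jm\rangle,\quad J_-|jm\rangle=\sqrt{[j+m]_q[j-m+1]_q}\,|j\,m-1\rangle,\quad J_+|jm\rangle=\sqrt{[j-m]_q[j+m+1]_q}\,|j\,m+1\rangle,$$ and $q^{aJ_0}|jm\rangle=q^{am}|jm\rangle$. On $D^{j_1}\otimes D^{j_2}$ (orthonormal basis $|j_1m_1\rangle|j_2m_2\rangle$) put $J_0(12)=J_0\otimes1+1\otimes J_0$ and $J_\pm(12)=J_\pm\otimes q^{J_0}+q^{-J_0}\otimes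 J_\pm$. Clebsch-Gordan coefficients. For $j\in\{|j_1-j_2|,\dots,j_1+j_2\}$ and $m\in\{-j,\dots,j\}$ let $$P^j_{mj}=\sqrt{\frac{[j+m]_q!}{[2j]_q!\,[j-m]_q!}}\sum_{r\ge0}\frac{(-1)^r[2j+1]_q!}{[r]_q!\,[2j+r+1]_q!}\,J_-(12)^{\,r+j-m}J_+(12)^{\,r}$$ (a finite sum, since $J_+(12)$ is nilpotent), and let $|j_1,j_2:jm\rangle$ be the unit vector $P^j_{mj}|j_1j_1\rangle|j_2\,j-j_1\rangle/\|P^j_{mj}|j_1j_1\rangle|j_2\,j-j_1\rangle\|$. For $m=m_1+m_2$, $\langle j_1m_1,j_2m_2|jm\rangle_q$ denotes the coefficient of $|j_1m_1\rangle|j_2m_2\rangle$ in $|j_1,j_2:jm\rangle$. The subscript indicates the base; $\langle\cdots\rangle_{1/q}$ is the same quantity with $q$ replaced by $1/q$ everywhere in the construction (in particular in the operators $J_\pm(12)$). *)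

(* Defs.v *)
From HB Require Import structures.
From mathcomp Require Import all_boot all_order all_algebra.
From mathcomp Require Import complex mxtens.
From mathcomp Require Import boolp classical_sets fsbigop reals exp.

Set Implicit Arguments.
Unset Strict Implicit.
Unset Printing Implicit Defensive.

Import Order.TTheory GRing.Theory Num.Theory.

Local Open Scope classical_set_scope.
Local Open Scope ring_scope.
Local Open Scope complex_scope.

(* A spin j in {0, 1/2, 1, ...} is encoded by the natural number n = 2j.  The  *)
(* magnetic numbers m = -j, -j+1, ..., j are encoded by the ordinals           *)
(* i = j + m : 'I_n.+1, so that j - m = n - i, and m |-> -m is rev_ord.        *)

Definition spin (R : realType) (n : nat) : R := n%:R / 2.

Definition mag (R : realType) (n : nat) (i : 'I_n.+1) : R :=
  i%:R - spin R n.

Lemma mag_rev_ord (R : realType) (n : nat) (i : 'I_n.+1) :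
  mag R (rev_ord i) = - mag R i.
Proof.
have le_in : (i <= n)%N by rewrite -ltnS.
rewrite /mag /spin /= subSS natrB // opprB addrAC; congr (_ - _).
by apply/eqP; rewrite subr_eq -splitr.
Qed.

(* j \in {|j1 - j2|, |j1 - j2| + 1, ..., j1 + j2}, for the doubled spins. *)
Definition triangle (n1 n2 n : nat) : bool :=
  (`|n1%:Z - n2%:Z| <= n <= n1 + n2)%N && (odd n == odd (n1 + n2)).

Definition qnum (R : realType) (q x : R) : R :=
  (q `^ x - q `^ (- x)) / (q - q^-1).

Definition qfact (R : realType) (q : R) (n : nat) : R :=
  \prod_(1 <= k < n.+1) qnum q k%:R.

(* D^j is the space of column vectors 'cV[R[i]]_n.+1 with its standard         *)
(* Hermitian inner product; |jm> is the i-th unit vector for m = mag i.        *)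

(* The vector |jm> for a real label m (0 if m is not in {-j, ..., j}). *)
Definition ket (R : realType) (n : nat) (m : R) : 'cV[R[i]]_n.+1 :=
  \col_(i < n.+1) (mag R i == m)%:R.

Definition Jminus (R : realType) (q : R) (n : nat) : 'M[R[i]]_n.+1 :=
  \matrix_(i < n.+1, k < n.+1)
    let j := spin R n in let m := mag R k in
    if mag R i == m - 1 then
      (Num.sqrt (qnum q (j + m) * qnum q (j - m + 1)))%:C else 0.

Definition Jplus (R : realType) (q : R) (n : nat) : 'M[R[i]]_n.+1 :=
  \matrix_(i < n.+1, k < n.+1)
    let j := spin R n in let m := mag R k in
    if mag R i == m + 1 then
      (Num.sqrt (qnum q (j - m) * qnum q (j + m + 1)))%:C else 0.

(* q^{a J_0} *)
Definition qJ0 (R : realType) (q a : R) (n : nat) : 'M[R[i]]_n.+1 :=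
  diag_mx (\row_(i < n.+1) (q `^ (a * mag R i))%:C).

(* D^{j1} (x) D^{j2} is 'cV[R[i]]_(n1.+1 * n2.+1): the Kronecker product _ *t _ *)
(* is the tensor product of vectors and of operators.                          *)

Definition Jminus12 (R : realType) (q : R) (n1 n2 : nat) :
    'M[R[i]]_(n1.+1 * n2.+1) :=
  Jminus q n1 *t qJ0 q 1 n2 + qJ0 q (-1) n1 *t Jminus q n2.

Definition Jplus12 (R : realType) (q : R) (n1 n2 : nat) :
    'M[R[i]]_(n1.+1 * n2.+1) :=
  Jplus q n1 *t qJ0 q 1 n2 + qJ0 q (-1) n1 *t Jplus q n2.

(* P^j_{mj} with m = mag i.  The sum runs over all r; it has finite support    *)
(* since Jplus12 is nilpotent.                                                 *)
Definition Pop (R : realType) (q : R) (n1 n2 n : nat) (i : 'I_n.+1) :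
    'M[R[i]]_(n1.+1 * n2.+1) :=
  (Num.sqrt (qfact q i / (qfact q n * qfact q (n - i))))%:C *:
  \sum_(r \in [set: nat])
     (((-1) ^+ r * qfact q n.+1 / (qfact q r * qfact q (n + r + 1)))%:C *:
       (Jminus12 q n1 n2 ^+ (r + (n - i)) *m Jplus12 q n1 n2 ^+ r)).

Definition vnorm (R : realType) (N : nat) (v : 'cV[R[i]]_N) : R[i] :=
  sqrtC (\sum_(k < N) `|v k 0| ^+ 2).

(* P^j_{mj} |j1 j1> |j2 j-j1> *)
Definition Pvec (R : realType) (q : R) (n1 n2 n : nat) (i : 'I_n.+1) :
    'cV[R[i]]_(n1.+1 * n2.+1) :=
  Pop q n1 n2 i *m (ket n1 (spin R n1) *t ket n2 (spin R n - spin R n1)).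

(* |j1, j2 : j m> *)
Definition coupled (R : realType) (q : R) (n1 n2 n : nat) (i : 'I_n.+1) :
    'cV[R[i]]_(n1.+1 * n2.+1) :=
  (vnorm (Pvec q n1 n2 i))^-1 *: Pvec q n1 n2 i.

(* <j1 m1, j2 m2 | j m>_q, with m1 = mag i1, m2 = mag i2, m = mag i *)
Definition CG (R : realType) (q : R) (n1 n2 n : nat)
    (i1 : 'I_n1.+1) (i2 : 'I_n2.+1) (i : 'I_n.+1) : R[i] :=
  coupled q n1 n2 i (mxtens_index (i1, i2)) 0.

(* Main.v *)
Require Import Defs.
From mathcomp Require Import all_boot all_order all_algebra.
From mathcomp Require Import complex reals exp.
From mathcomp Require Import mxtens classical_sets fsbigop ring zify.
Import Order.TTheory GRing.Theory Num.Theory.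
Set Implicit Arguments.
Unset Strict Implicit.
Unset Printing Implicit Defensive.
Local Open Scope ring_scope.

(** Both sides of the identity, as functions of [(m1, m2, m)], satisfy the same
    two three-term recurrences, which express that the coupled basis spans a
    copy of [D^j]: exchanging [(j1, m1)] with [(j, -m)] swaps the term that
    shifts [m] with the one that shifts [m1], and the factor
    [(-1)^(j2+m2) q^(-m2)] absorbs the signs and the powers of [q].
    Since a highest weight vector of given weight is unique up to a scalar,
    the two sides are proportional.

    The scalar is positive because both sides are positive at the corner
    [m1 = j1, m2 = -j2]; its square is 1 by computing the sum of
    [q^(2m) |.|^2] over all [m1, m2, m] in two ways: the weight [q^(2m - 2m2)]
    is [q^(2m1)], so both computations reduce to [sum_m q^(2m) = [2j+1]].

    That the extremal projector does produce the coupled basis rests on a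
    telescoping sum (its image is killed by [J_+]), on [J_- = J_+^*], and on
    the existence of a highest weight vector not orthogonal to the seed
    [|j1 j1>|j2 j-j1>], which makes the projection of the seed nonzero.

    Spins are parametrized by naturals [x, y, z] with
    [2 j1 = x + y], [2 j2 = x + z], [2 j = y + z]. *)

Lemma exprS_mulmx (R : pzRingType) N (A : 'M[R]_N) k p (v : 'M[R]_(N, p)) :
  A ^+ k.+1 *m v = A *m (A ^+ k *m v).
Proof. by rewrite exprS -mulmxE mulmxA. Qed.

(** * Hermitian inner product and adjoint operators *)

Section InnerProduct.
Variables (C : numClosedFieldType) (N : nat).
Implicit Types (u v w : 'cV[C]_N) (A : 'M[C]_N).

Definition dot u v : C := \sum_(k < N) (u k 0)^* * v k 0.

Lemma dotDr u v w : dot u (v + w) = dot u v + dot u w.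
Proof. by rewrite -big_split; apply: eq_bigr => k _; rewrite mxE mulrDr. Qed.

Lemma dotZr u a v : dot u (a *: v) = a * dot u v.
Proof. by rewrite mulr_sumr; apply: eq_bigr => k _; rewrite mxE mulrCA. Qed.

Lemma dot0r u : dot u 0 = 0.
Proof. by rewrite -(scale0r 0) dotZr mul0r. Qed.

Lemma dot_sumr u (I : Type) (r : seq I) (P : pred I) (f : I -> 'cV[C]_N) :
  dot u (\sum_(i <- r | P i) f i) = \sum_(i <- r | P i) dot u (f i).
Proof. exact: (big_morph (dot u) (dotDr u) (dot0r u)). Qed.

Lemma dotC u v : dot u v = (dot v u)^*.
Proof.
rewrite rmorph_sum; apply: eq_bigr => k _ /=.
by rewrite rmorphM /= conjCK mulrC.
Qed.

Lemma dot0l v : dot 0 v = 0.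
Proof. by rewrite dotC dot0r conjC0. Qed.

Lemma dot_norm v : dot v v = \sum_(k < N) `|v k 0| ^+ 2.
Proof. by apply: eq_bigr => k _; rewrite normCK mulrC. Qed.

Lemma dot_ge0 v : 0 <= dot v v.
Proof. by rewrite dot_norm sumr_ge0 // => k _; rewrite exprn_ge0. Qed.

Lemma dot_eq0 v : (dot v v == 0) = (v == 0).
Proof.
apply/eqP/eqP => [|->]; last exact: dot0r.
rewrite dot_norm => /eqP; rewrite psumr_eq0 => [/allP v0|k _].
  apply/matrixP => k l; rewrite mxE ord1.
  by have := v0 k (mem_index_enum _); rewrite /= sqrf_eq0 normr_eq0 => /eqP.
by rewrite exprn_ge0.
Qed.

Lemma dot_adj (A B : 'M[C]_N) u v : (forall i k, B i k = (A k i)^*) ->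
  dot (A *m u) v = dot u (B *m v).
Proof.
move=> AB; rewrite /dot.
transitivity (\sum_k \sum_l (u l 0)^* * ((A k l)^* * v k 0)).
  apply: eq_bigr => k _; rewrite mxE rmorph_sum /= mulr_suml.
  by apply: eq_bigr => l _; rewrite rmorphM /=; ring.
rewrite exchange_big; apply: eq_bigr => l _; rewrite mxE mulr_sumr.
by apply: eq_bigr => k _; rewrite AB.
Qed.

Lemma dot_adjX (A B : 'M[C]_N) r u v : (forall i k, B i k = (A k i)^*) ->
  dot (A ^+ r *m u) v = dot u (B ^+ r *m v).
Proof.
move=> AB; elim: r u v => [|r IHr] u v; first by rewrite !expr0 !mul1mx.
rewrite exprS_mulmx (dot_adj _ _ AB) IHr.
by rewrite exprSr -mulmxE mulmxA.
Qed.

End InnerProduct.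

(** * Extremal projector *)

Section ExtremalProjector.
(** Abstract setting: [E] and [F] stand for $J_+$ and $J_-$, [qn] for the $q$-integers, and
    [has_weight w v] for $J_0v=(w/2)v$. Weights are doubled so as to be integers. *)
Variables (C : numClosedFieldType) (N : nat) (E F : 'M[C]_N).
Variables (has_weight : int -> 'cV[C]_N -> Prop) (qn : int -> C).
Hypothesis qn0 : qn 0 = 0.
Hypothesis qn_gt0 : forall k : nat, 0 < qn k.+1.
Hypothesis qn_rec : forall w k : int,
  qn k * qn (w - k + 1) + qn (w - k *+ 2) = qn (k + 1) * qn (w - k).
Hypothesis FE : forall i k, F i k = (E k i)^*.
Hypothesis weight_raise : forall w v, has_weight w v -> has_weight (w + 2) (E *m v).
Hypothesis weight_lower : forall w v, has_weight w v -> has_weight (w - 2) (F *m v).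
Hypothesis comm_raise_lower : forall w v, has_weight w v ->
  E *m (F *m v) = F *m (E *m v) + qn w *: v.

Definition qfactorial (k : nat) : C := \prod_(1 <= l < k.+1) qn l.

Lemma qfactorialS k : qfactorial k.+1 = qfactorial k * qn k.+1.
Proof. by rewrite /qfactorial big_nat_recr. Qed.

Lemma qfactorial0 : qfactorial 0 = 1.
Proof. by rewrite /qfactorial big_geq. Qed.

Lemma qfactorial_gt0 k : 0 < qfactorial k.
Proof. by elim: k => [|k IHk]; rewrite ?qfactorial0 // qfactorialS mulr_gt0. Qed.

Lemma qfactorial_neq0 k : qfactorial k != 0.
Proof. by rewrite gt_eqF ?qfactorial_gt0. Qed.

Lemma weight_lowerX w v k : has_weight w v -> has_weight (w - k%:Z *+ 2) (F ^+ k *m v).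
Proof.
move=> wv; elim: k => [|k /weight_lower IHk].
  by rewrite expr0 mul1mx mul0rn subr0.
by rewrite exprS_mulmx; have -> : w - k.+1%:Z *+ 2 = w - k%:Z *+ 2 - 2 by lia.
Qed.

Lemma weight_raiseX w v k : has_weight w v -> has_weight (w + k%:Z *+ 2) (E ^+ k *m v).
Proof.
move=> wv; elim: k => [|k /weight_raise IHk].
  by rewrite expr0 mul1mx mul0rn addr0.
by rewrite exprS_mulmx; have -> : w + k.+1%:Z *+ 2 = w + k%:Z *+ 2 + 2 by lia.
Qed.

(** Each further [F] that [E] passes contributes $[w-2k]$, since $F^kv$ has weight $w-2k$; [qn_rec]
    is the identity that sums these contributions. *)
Lemma comm_raise_lowerX w v k : has_weight w v ->
  E *m (F ^+ k.+1 *m v) =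
  F ^+ k.+1 *m (E *m v) + (qn k.+1 * qn (w - k%:Z)) *: (F ^+ k *m v).
Proof.
move=> wv; elim: k => [|k IHk].
  rewrite !expr1 (comm_raise_lower wv) expr0 mul1mx subr0; congr (_ + _ *: _).
  by have := qn_rec w 0; rewrite qn0 mul0r mul0rn !subr0 !add0r => <-.
rewrite exprS_mulmx (comm_raise_lower (weight_lowerX k.+1 wv)) IHk mulmxDr -scalemxAr.
rewrite -!exprS_mulmx -addrA -scalerDl; congr (_ + _ *: _).
have -> : w - k%:Z = w - k.+1%:Z + 1 by lia.
by rewrite qn_rec; congr (qn _ * _); lia.
Qed.

Variables (n M : nat) (u : 'cV[C]_N).
Hypothesis wu : has_weight n u.
Hypothesis nilu : E ^+ M.+1 *m u = 0.

Definition proj_coef (r : nat) : C :=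
  (-1) ^+ r * qfactorial n.+1 / (qfactorial r * qfactorial (n + r + 1)).

(** This is $P^j_{jj}u$ with $n=2j$: for $m=j$ the square root in front of the projector equals
    1. *)
Definition extremal_proj : 'cV[C]_N :=
  \sum_(r < M.+1) proj_coef r *: (F ^+ r *m (E ^+ r *m u)).

Lemma proj_coef0 : proj_coef 0 = 1.
Proof.
by rewrite /proj_coef expr0 qfactorial0 !mul1r addn0 addn1 divff ?qfactorial_neq0.
Qed.

(** Commuting [E] through $F^{r+1}$ on weight $n+2(r+1)$ produces the factor $[r+1][n+r+2]$; the
    coefficients are such that this term cancels the one left over from index [r]. *)
Lemma proj_coefS r : proj_coef r.+1 * (qn r.+1 * qn (n + r.+1 + 1)%N) = - proj_coef r.
Proof.
rewrite /proj_coef (qfactorialS r).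
have -> : (n + r.+1 + 1)%N = (n + r + 1).+1 by lia.
rewrite (qfactorialS (n + r + 1)) exprS.
have := qfactorial_neq0 r; have := qfactorial_neq0 (n + r + 1).
have := qn_gt0 r; have := qn_gt0 (n + r + 1).
move=> /gt_eqF/negbT h1 /gt_eqF/negbT h2 h3 h4.
by field; rewrite h1 h2 h3 h4.
Qed.

(* The sum over [r] telescopes once [E] has been commuted through [F ^+ r]. *)
Lemma raise_extremal_proj : E *m extremal_proj = 0.
Proof.
suff H m : E *m (\sum_(r < m.+1) proj_coef r *: (F ^+ r *m (E ^+ r *m u))) =
    proj_coef m *: (F ^+ m *m (E ^+ m.+1 *m u)).
  by rewrite H nilu mulmx0 scaler0.
elim: m => [|m IHm].
  by rewrite big_ord1 -scalemxAr !expr0 !mul1mx expr1.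
rewrite big_ord_recr /= mulmxDr IHm -scalemxAr.
rewrite (comm_raise_lowerX m (weight_raiseX m.+1 wu)) -exprS_mulmx.
rewrite scalerDr scalerA addrCA.
have -> : (n%:Z + m.+1%:Z *+ 2 - m%:Z) = (n + m.+1 + 1)%N by lia.
by rewrite proj_coefS scaleNr subrr addr0.
Qed.

(** Since $F=E^*$, every term with $r\ge1$ is orthogonal to the kernel of [E]; only $r=0$, the
    vector [u] itself, survives. *)
Lemma dot_extremal_proj g : E *m g = 0 -> dot g extremal_proj = dot g u.
Proof.
move=> Eg; rewrite dot_sumr big_ord_recl proj_coef0 scale1r !expr0 !mul1mx.
rewrite big1 ?addr0 // => r _; rewrite dotZr -(dot_adjX _ _ _ FE) /=.
by rewrite exprSr -mulmxE -mulmxA Eg mulmx0 dot0l mulr0.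
Qed.

Lemma weight_extremal_proj :
  (forall w v v', has_weight w v -> has_weight w v' -> has_weight w (v + v')) ->
  (forall w a v, has_weight w v -> has_weight w (a *: v)) ->
  has_weight n extremal_proj.
Proof.
move=> wtD wtZ.
have wt0 : has_weight n 0 by rewrite -(scale0r u); apply: wtZ.
rewrite /extremal_proj; elim/big_ind: _ => // [x y|r _]; first exact: wtD.
by apply: wtZ; have := weight_lowerX r (weight_raiseX r wu); rewrite addrK.
Qed.

End ExtremalProjector.

(** * Norms along the chain below a highest weight vector *)

Section LoweringChain.
Variables (C : numClosedFieldType) (N : nat) (E F : 'M[C]_N).
Variables (has_weight : int -> 'cV[C]_N -> Prop) (qn : int -> C).
Hypothesis qn0 : qn 0 = 0.
Hypothesis qn_gt0 : forall k : nat, 0 < qn k.+1.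
Hypothesis qn_rec : forall w k : int,
  qn k * qn (w - k + 1) + qn (w - k *+ 2) = qn (k + 1) * qn (w - k).
Hypothesis FE : forall i k, F i k = (E k i)^*.
Hypothesis weight_lower : forall w v, has_weight w v -> has_weight (w - 2) (F *m v).
Hypothesis comm_raise_lower : forall w v, has_weight w v ->
  E *m (F *m v) = F *m (E *m v) + qn w *: v.
Variables (n : nat) (h : 'cV[C]_N).
Hypothesis wh : has_weight n h.
Hypothesis Eh : E *m h = 0.

Lemma raise_chain k : E *m (F ^+ k.+1 *m h) =
  (qn k.+1 * qn (n%:Z - k%:Z)) *: (F ^+ k *m h).
Proof.
rewrite (comm_raise_lowerX qn0 qn_rec weight_lower comm_raise_lower k wh).
by rewrite Eh mulmx0 add0r.
Qed.

Lemma dot_chainS k : dot (F ^+ k.+1 *m h) (F ^+ k.+1 *m h) =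
  qn k.+1 * qn (n%:Z - k%:Z) * dot (F ^+ k *m h) (F ^+ k *m h).
Proof.
have EF i l : E i l = (F l i)^* by rewrite FE conjCK.
by rewrite {1}exprS_mulmx (dot_adj _ _ EF) raise_chain dotZr.
Qed.

Lemma dot_chain k : (k <= n)%N -> dot (F ^+ k *m h) (F ^+ k *m h) =
  qfactorial qn k * qfactorial qn n / qfactorial qn (n - k) * dot h h.
Proof.
have qfactorial_neq0 := qfactorial_neq0 qn_gt0.
elim: k => [|k IHk] lekn.
  by rewrite expr0 mul1mx qfactorial0 subn0 mul1r divff // mul1r.
rewrite dot_chainS (IHk (ltnW lekn)) qfactorialS.
have -> : (n - k)%N = (n - k.+1).+1 by lia.
rewrite qfactorialS; have -> : (n%:Z - k%:Z) = (n - k.+1).+1 by lia.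
have := qn_gt0 (n - k.+1) => /gt_eqF/negbT h1.
by field; rewrite h1 qfactorial_neq0.
Qed.

(** The squared norm carries the factor $[n-n]=0$. *)
Lemma chain_end : F ^+ n.+1 *m h = 0.
Proof.
by apply/eqP; rewrite -dot_eq0 dot_chainS subrr qn0 mulr0 mul0r.
Qed.

End LoweringChain.

Local Open Scope complex_scope.

Lemma sum_mxtens (V : nmodType) m p (f : 'I_(m * p) -> V) :
  \sum_k f k = \sum_c \sum_d f (mxtens_index (c, d)).
Proof.
rewrite pair_big (reindex (@mxtens_index m p)) /=; last first.
  by exists (@mxtens_unindex m p) => k _; rewrite ?mxtens_indexK ?mxtens_unindexK.
by apply: eq_bigr => -[c d].
Qed.

Lemma mulmx_eq0 (R : pzSemiRingType) m p (A : 'M[R]_(m, p)) :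
  (forall v : 'cV_p, A *m v = 0) -> A = 0.
Proof.
move=> Av0; apply/matrixP => i k.
by have /matrixP/(_ i 0) := Av0 (delta_mx k 0); rewrite -colE !mxE.
Qed.

(** * q-numbers and ladder operators *)

Section QNumbers.
Variables (R : realType) (q : R).

Lemma qnum0 : qnum q 0 = 0.
Proof. by rewrite /qnum oppr0 subrr mul0r. Qed.

Hypothesis q_gt0 : 0 < q.

Lemma powRinv x : q^-1 `^ x = q `^ (- x).
Proof. by rewrite -powR_inv1 ?ltW // -powRrM mulN1r. Qed.

(** Numerator and denominator both change sign. Hence replacing $q$ by $1/q$ alters the powers of
    $q$ in the operators but not the ladder coefficients. *)
Lemma qnum_inv x : qnum q^-1 x = qnum q x.
Proof.
rewrite /qnum !powRinv opprK invrK.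
by rewrite -[q^-1 - q]opprB invrN mulrN -mulNr opprB.
Qed.

Hypothesis q_neq1 : q != 1.

Lemma qdiff_neq0 : q - q^-1 != 0.
Proof.
rewrite subr_eq0 -(inj_eq (mulfI (lt0r_neq0 q_gt0))) divff ?lt0r_neq0 //.
by rewrite -expr2 sqrf_eq1 negb_or q_neq1 gt_eqF // (lt_trans _ q_gt0) ?oppr_lt0.
Qed.

Lemma qnum1 : qnum q 1 = 1.
Proof. by rewrite /qnum powR_inv1 ?powRr1 ?ltW // divff // qdiff_neq0. Qed.

Lemma powRDgt x y : q `^ (x + y) = q `^ x * q `^ y.
Proof. by rewrite powRD // lt0r_neq0 // implybT. Qed.

Lemma powR_neq0 x : q `^ x != 0.
Proof. by rewrite lt0r_neq0 // powR_gt0. Qed.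

Lemma qnum_rec w k : qnum q k * qnum q (w - k + 1) + qnum q (w - k *+ 2) =
  qnum q (k + 1) * qnum q (w - k).
Proof.
have q0 := lt0r_neq0 q_gt0; have d0 := qdiff_neq0.
(* [field] clears the inverse in $q-q^{-1}$ and then asks for this form of the denominator. *)
have d1 : q * q - 1 != 0.
  have -> : q * q - 1 = q * (q - q^-1) by rewrite mulrBr divff.
  exact: mulf_neq0.
rewrite /qnum mulr2n !opprD !opprK !powRDgt !powRN.
rewrite !powRr1 ?ltW //.
have k0 := powR_neq0 k; have w0 := powR_neq0 w.
by field; rewrite d1 q0 k0 w0.
Qed.

(** The asymmetric powers $q^y$ and $q^{-x}$ match those in $J_\pm(12)$; this form is what the
    commutator on the tensor product needs. *)
Lemma qnumD x y : qnum q (x + y) = q `^ y * qnum q x + q `^ (- x) * qnum q y.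
Proof.
rewrite /qnum opprD !powRDgt.
by ring.
Qed.

Lemma qnum_gt0 x : 0 < x -> 0 < qnum q x.
Proof.
have gt1 (p : R) : 1 < p -> 0 < x -> 0 < qnum p x.
  move=> p1 x0; have p0 : 0 < p by rewrite (lt_trans _ p1).
  have ltV (t : R) : 1 < t -> t^-1 < t.
    move=> t1; have t0 : 0 < t by rewrite (lt_trans _ t1).
    by rewrite (lt_trans _ t1) // invf_lt1.
  rewrite /qnum divr_gt0 // subr_gt0 ?ltV // powRN ltV //.
  have <- : 1 `^ x = 1 :> R by rewrite powR1.
  by rewrite gt0_ltr_powR // nnegrE ltW.
move: q_neq1; rewrite neq_lt => /orP[q1|] x0; last by move/gt1; apply.
by rewrite -qnum_inv gt1 // invf_gt1.
Qed.

Lemma qnum_ge0 x : 0 <= x -> 0 <= qnum q x.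
Proof. by rewrite le_eqVlt => /predU1P[<-|/qnum_gt0/ltW//]; rewrite qnum0. Qed.

Lemma sum_powR_qnum n :
  \sum_(i < n.+1) q `^ (i%:R *+ 2 - n%:R) = qnum q n.+1%:R.
Proof.
have H m : \sum_(i < m) q `^ (i%:R *+ 2) = q `^ (m%:R - 1) * qnum q m%:R.
  elim: m => [|m IHm]; first by rewrite big_ord0 qnum0 mulr0.
  rewrite big_ord_recr /= IHm -natr1 addrK [X in _ = _ * qnum q X]addrC qnumD.
  rewrite qnum1 mulr1 mulrDr -!powRDgt mulrA -powRDgt addrC; congr (_ + _ * _).
under eq_bigr do rewrite powRDgt.
rewrite -mulr_suml H -natr1 addrK mulrAC -powRDgt subrr powRr0 mul1r.
by [].
Qed.

End QNumbers.

(* Twice the magnetic number of the ket of index [a] in [D^(n/2)]. *)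
Definition twom n a : int := a%:Z *+ 2 - n%:Z.

Lemma twomS n a : twom n a.+1 = twom n a + 2.
Proof. by rewrite /twom; lia. Qed.

(** * Matrix elements on a single spin *)

Section Coefficients.
Variables (R : realType) (q : R).

Definition qint (w : int) : R[i] := (qnum q w%:~R)%:C.
(* Indexed by twice the exponent, to handle half-integral powers of [q]. *)
Definition qpow (w : int) : R[i] := (q `^ (w%:~R / 2))%:C.
(* The matrix element of [J_-] from the ket of index [k] to that of index
   [k - 1]; it vanishes at both ends [k = 0] and [k = n + 1], so that
   three-term recurrences need no boundary cases. *)
Definition ladder (n k : nat) : R[i] :=
  (Num.sqrt (qnum q k%:R * qnum q (n%:R - k%:R + 1)))%:C.

Lemma qint0 : qint 0 = 0.
Proof. by rewrite /qint mulr0z qnum0. Qed.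

Lemma qintN w : qint (- w) = - qint w.
Proof. by rewrite /qint -rmorphN /= mulrNz /qnum opprK -mulNr opprB. Qed.

Lemma qpow0 : qpow 0 = 1.
Proof. by rewrite /qpow mul0r powRr0. Qed.

Lemma ladder0 n : ladder n 0 = 0.
Proof. by rewrite /ladder qnum0 mul0r sqrtr0. Qed.

Lemma ladder_end n : ladder n n.+1 = 0.
Proof.
rewrite /ladder; have -> : n%:R - n.+1%:R + 1 = 0 :> R by rewrite -natr1; ring.
by rewrite qnum0 mulr0 sqrtr0.
Qed.

Lemma ladder_arg_ge0 n k : (k <= n.+1)%N -> 0 <= n%:R - k%:R + 1 :> R.
Proof. by move=> kn; rewrite addrAC natr1 subr_ge0 ler_nat. Qed.

(** The reflection $m\mapsto-m$ exchanges the matrix elements of $J_-$ and $J_+$. *)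
Lemma ladder_rev n k : (k <= n)%N -> ladder n (n - k) = ladder n k.+1.
Proof.
move=> kn; rewrite /ladder natrB // subKr natr1 mulrC -natr1.
by rewrite opprD addrA subrK.
Qed.

Lemma JminusE n (i k : 'I_n.+1) :
  Jminus q n i k = if (k == i.+1 :> nat) then ladder n k else 0.
Proof.
rewrite mxE /mag /spin.
have -> : (i%:R - n%:R / 2 == k%:R - n%:R / 2 - 1 :> R) = (k == i.+1 :> nat).
  rewrite addrAC (inj_eq (addIr _)) eq_sym subr_eq natr1 eqr_nat //.
case: ifP => // _; rewrite /ladder.
by congr (Num.sqrt (qnum _ _ * qnum _ _))%:C; field.
Qed.

Lemma JplusE n (i k : 'I_n.+1) : Jplus q n i k = Jminus q n k i.
Proof.
rewrite JminusE mxE /mag /spin.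
have -> : (i%:R - n%:R / 2 == k%:R - n%:R / 2 + 1 :> R) = (i == k.+1 :> nat).
  by rewrite addrAC (inj_eq (addIr _)) natr1 eqr_nat.
case: eqP => // ->; rewrite /ladder mulrC -natr1.
by congr (Num.sqrt (qnum _ _ * qnum _ _))%:C; field.
Qed.

Lemma qJ0E n (i k : 'I_n.+1) (s : int) :
  qJ0 q s%:~R n i k = if (i == k :> nat) then qpow (s * twom n i) else 0.
Proof.
rewrite !mxE; have -> : (i == k) = (i == k :> nat) by [].
case: eqP => [_|//]; rewrite mulr1n /qpow /mag /spin /twom.
congr (q `^ _)%:C; rewrite intrM intrD mulrNz.
rewrite mulr2n intrD.
by field.
Qed.

(** [f] is defined on all naturals, so [f i.+1] makes sense at [i = n], where its coefficient
    vanishes. *)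
Lemma sum_Jminus n (i : 'I_n.+1) (f : nat -> R[i]) :
  \sum_(k < n.+1) Jminus q n i k * f k = ladder n i.+1 * f i.+1.
Proof.
under eq_bigr do rewrite JminusE.
have [iltn|] := boolP (i.+1 < n.+1)%N.
  rewrite (bigD1 (Ordinal iltn)) //= eqxx big1 ?addr0 // => k.
  by rewrite -val_eqE /= => /negbTE ->; rewrite mul0r.
rewrite -leqNgt => nlei; have -> : i = n :> nat by have := ltn_ord i; lia.
rewrite ladder_end mul0r big1 // => k _; case: eqP => [ki|_]; last exact: mul0r.
by have := ltn_ord k; rewrite ki ltnn.
Qed.

Lemma sum_Jplus n (i : 'I_n.+1) (f : nat -> R[i]) :
  \sum_(k < n.+1) Jplus q n i k * f k = ladder n i * f i.-1.
Proof.
under eq_bigr do rewrite JplusE JminusE.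
(* At [i = 0] the truncated predecessor gives [f 0], which is killed by [ladder n 0 = 0]. *)
have [i0|i0] := posnP i.
  by rewrite i0 ladder0 mul0r big1 // => k _; rewrite mul0r.
have iltn : (i.-1 < n.+1)%N by have := ltn_ord i; lia.
rewrite (bigD1 (Ordinal iltn)) //= prednK // eqxx big1 ?addr0 // => k.
by rewrite -val_eqE /= => ki; case: eqP => [|_]; [lia|rewrite mul0r].
Qed.

Lemma sum_qJ0 n (i : 'I_n.+1) (s : int) (f : nat -> R[i]) :
  \sum_(k < n.+1) qJ0 q s%:~R n i k * f k = qpow (s * twom n i) * f i.
Proof.
rewrite (bigD1 i) //= qJ0E eqxx big1 ?addr0 // => k.
by rewrite qJ0E eq_sym -val_eqE => /negbTE ->; rewrite mul0r.
Qed.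

Hypothesis q_gt0 : 0 < q.
Hypothesis q_neq1 : q != 1.

Lemma qint_gt0 (k : nat) : 0 < qint k.+1.
Proof. by rewrite ltcR qnum_gt0 // -pmulrn ltr0n. Qed.

Lemma qint_rec w k :
  qint k * qint (w - k + 1) + qint (w - k *+ 2) = qint (k + 1) * qint (w - k).
Proof.
by rewrite /qint -!rmorphM -rmorphD /= !mulr2n !(intrD, mulrNz) -mulr2n qnum_rec.
Qed.

Lemma qpowD v w : qpow (v + w) = qpow v * qpow w.
Proof. by rewrite /qpow -rmorphM -powRDgt // intrD mulrDl. Qed.

Lemma qpow_gt0 w : 0 < qpow w.
Proof. by rewrite ltcR powR_gt0. Qed.

Lemma qpow_neq0 w : qpow w != 0.
Proof. by rewrite lt0r_neq0 ?qpow_gt0. Qed.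

Lemma qpowN w : qpow (- w) = (qpow w)^-1.
Proof.
by apply: (mulfI (qpow_neq0 w)); rewrite -qpowD subrr qpow0 divff ?qpow_neq0.
Qed.

Lemma qintD v w : qint (v + w) = qpow w ^+ 2 * qint v + qpow (- v) ^+ 2 * qint w.
Proof.
rewrite /qint /qpow -!rmorphXn -!rmorphM -rmorphD /= intrD qnumD //.
by rewrite !expr2 -!powRDgt // -!splitr mulrNz.
Qed.

Lemma ladder_sqr n k : (k <= n.+1)%N ->
  ladder n k ^+ 2 = qint k * qint (n%:Z - k%:Z + 1).
Proof.
move=> kn; rewrite /ladder -rmorphXn sqr_sqrtr /=; last first.
  by rewrite mulr_ge0 ?qnum_ge0 ?ladder_arg_ge0.
by rewrite rmorphM /qint !intrD mulrNz.
Qed.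

Lemma ladder_gt0 n k : (0 < k <= n)%N -> 0 < ladder n k.
Proof.
case/andP=> k0 kn; rewrite ltcR sqrtr_gt0 mulr_gt0 ?qnum_gt0 ?ltr0n //.
by rewrite addrAC natr1 subr_gt0 ltr_nat ltnS.
Qed.

Lemma ladder_neq0 n k : (0 < k <= n)%N -> ladder n k != 0.
Proof. by move=> kn; rewrite lt0r_neq0 ?ladder_gt0. Qed.

(** The relation $[J_+,J_-]=[2J_0]$ on a single spin, read off the diagonal. *)
Lemma ladder_diff n a : (a <= n)%N ->
  ladder n a ^+ 2 - ladder n a.+1 ^+ 2 = qint (twom n a).
Proof.
move=> an; rewrite (ladder_sqr (leqW an)) ladder_sqr //.
have -> : n%:Z - a.+1%:Z + 1 = n%:Z - a%:Z by lia.
have -> : a.+1%:Z = a%:Z + 1 by lia.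
rewrite -(qint_rec n%:Z a%:Z) opprD addrA subrr sub0r -qintN.
by rewrite /twom opprB.
Qed.

End Coefficients.

(** * Weights, adjointness and commutator on the tensor product *)

Section TensorProduct.
Variables (R : realType) (q : R) (n1 n2 : nat).
Implicit Types v : 'cV[R[i]]_(n1.+1 * n2.+1).

Local Notation E := (Jplus12 q n1 n2).
Local Notation F := (Jminus12 q n1 n2).
Local Notation A1 := (ladder q n1).
Local Notation A2 := (ladder q n2).
Local Notation P b := (qpow q (twom n2 b)).
Local Notation Q a := (qpow q (- twom n1 a)).

(* The coordinate of [v] along |j1 m1>|j2 m2> with a = j1 + m1 and b = j2 + m2. *)
Definition coord v (a b : nat) : R[i] :=
  if (a <= n1)%N && (b <= n2)%N then v (mxtens_index (inord a, inord b)) 0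
  else 0.

Lemma coordE v (a : 'I_n1.+1) (b : 'I_n2.+1) : coord v a b = v (mxtens_index (a, b)) 0.
Proof. by rewrite /coord !inord_val !leq_ord. Qed.

Lemma coord_out v a b : ~~ ((a <= n1)%N && (b <= n2)%N) -> coord v a b = 0.
Proof. by rewrite /coord => /negbTE ->. Qed.

Lemma coord_ext u v :
  (forall a b, (a <= n1)%N -> (b <= n2)%N -> coord u a b = coord v a b) -> u = v.
Proof.
move=> uv; apply/matrixP => k l; rewrite ord1; case: (mxtens_indexP k) => a b.
by rewrite -!coordE uv // leq_ord.
Qed.

Lemma coordD u v a b : coord (u + v) a b = coord u a b + coord v a b.
Proof. by rewrite /coord; case: ifP; rewrite ?mxE ?addr0. Qed.

Lemma coordZ c v a b : coord (c *: v) a b = c * coord v a b.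
Proof. by rewrite /coord; case: ifP; rewrite ?mxE ?mulr0. Qed.

Lemma coord_tens_mul (M1 M1' : 'M[R[i]]_n1.+1) (M2 M2' : 'M[R[i]]_n2.+1) v
    (a : 'I_n1.+1) (b : 'I_n2.+1) :
  coord ((M1 *t M2 + M1' *t M2') *m v) a b =
  \sum_c M1 a c * (\sum_d M2 b d * coord v c d) +
  \sum_c M1' a c * (\sum_d M2' b d * coord v c d).
Proof.
rewrite coordE mxE sum_mxtens -big_split /=; apply: eq_bigr => c _.
rewrite !mulr_sumr -big_split /=; apply: eq_bigr => d _.
by rewrite mxE !tensmxE coordE mulrDl !mulrA.
Qed.

Lemma coord_Jminus12 v a b : (a <= n1)%N -> (b <= n2)%N ->
  coord (F *m v) a b = A1 a.+1 * P b * coord v a.+1 b + Q a * A2 b.+1 * coord v a b.+1.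
Proof.
move=> an bn; have := coord_tens_mul (Jminus q n1) (qJ0 q (-1) n1)
  (qJ0 q 1 n2) (Jminus q n2) v
  (Ordinal (an : (a < n1.+1)%N)) (Ordinal (bn : (b < n2.+1)%N)).
rewrite /Jminus12 => -> /=.
under eq_bigr do rewrite (@sum_qJ0 _ _ _ _ 1).
under [X in _ + X]eq_bigr do rewrite sum_Jminus.
rewrite (@sum_Jminus _ _ _ _ (fun c => qpow q (1 * twom n2 b) * coord v c b)).
rewrite (@sum_qJ0 _ _ _ _ (-1) (fun c => A2 b.+1 * coord v c b.+1)).
by rewrite mul1r mulN1r !mulrA.
Qed.

Lemma coord_Jplus12 v a b : (a <= n1)%N -> (b <= n2)%N ->
  coord (E *m v) a b = A1 a * P b * coord v a.-1 b + Q a * A2 b * coord v a b.-1.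
Proof.
move=> an bn; have := coord_tens_mul (Jplus q n1) (qJ0 q (-1) n1)
  (qJ0 q 1 n2) (Jplus q n2) v
  (Ordinal (an : (a < n1.+1)%N)) (Ordinal (bn : (b < n2.+1)%N)).
rewrite /Jplus12 => -> /=.
under eq_bigr do rewrite (@sum_qJ0 _ _ _ _ 1).
under [X in _ + X]eq_bigr do rewrite sum_Jplus.
rewrite (@sum_Jplus _ _ _ _ (fun c => qpow q (1 * twom n2 b) * coord v c b)).
rewrite (@sum_qJ0 _ _ _ _ (-1) (fun c => A2 b * coord v c b.-1)).
by rewrite mul1r mulN1r !mulrA.
Qed.

(** Eigenvectors of $J_0(12)$ for $w/2$, described by their support; the zero vector has every
    weight. *)
Definition has_weight (w : int) v : Prop :=
  forall a b, coord v a b != 0 -> (a + b)%:Z *+ 2 - (n1 + n2)%:Z = w.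

Lemma has_weightD w u v : has_weight w u -> has_weight w v -> has_weight w (u + v).
Proof.
move=> wu wv a b; rewrite coordD; have [u0|] := eqVneq (coord u a b) 0.
  by rewrite u0 add0r; apply: wv.
by move=> u0 _; apply: wu.
Qed.

Lemma has_weightZ w c v : has_weight w v -> has_weight w (c *: v).
Proof. by move=> wv a b; rewrite coordZ mulf_eq0 negb_or => /andP[_ /wv]. Qed.

Lemma coord_eq0_weight w v a b : has_weight w v ->
  (a + b)%:Z *+ 2 - (n1 + n2)%:Z != w ->
  coord v a b = 0.
Proof. by move=> wv; apply: contraNeq => /wv ->. Qed.

Lemma has_weight_Jminus12 w v : has_weight w v -> has_weight (w - 2) (F *m v).
Proof.
move=> wv a b; apply: contraNeq => Dw.
have [/andP[an bn]|] := boolP ((a <= n1)%N && (b <= n2)%N); last by move/coord_out->.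
rewrite coord_Jminus12 // !(coord_eq0_weight wv) ?mulr0 ?addr0 //.
all: by apply: contra Dw => /eqP <-; apply/eqP; lia.
Qed.

Lemma has_weight_Jplus12 w v : has_weight w v -> has_weight (w + 2) (E *m v).
Proof.
move=> wv a b; apply: contraNeq => Dw.
have [/andP[an bn]|] := boolP ((a <= n1)%N && (b <= n2)%N); last by move/coord_out->.
rewrite coord_Jplus12 //.
have -> : A1 a * P b * coord v a.-1 b = 0.
  case: a Dw {an} => [|a] Dw; first by rewrite ladder0 !mul0r.
  rewrite (coord_eq0_weight wv) ?mulr0 //.
  by apply: contra Dw => /eqP <-; apply/eqP; lia.
case: b Dw {bn} => [|b] Dw; first by rewrite ladder0 mulr0 mul0r addr0.
rewrite (coord_eq0_weight wv) ?mulr0 ?addr0 //.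
by apply: contra Dw => /eqP <-; apply/eqP; lia.
Qed.

Lemma Jminus12_adj k l : F k l = (E l k)^*%R.
Proof.
have conjR (x : R) : (x%:C)^*%R = x%:C.
  by apply: conj_Creal; rewrite complex_real.
have Jconj m (a c : 'I_m.+1) : (Jminus q m a c)^*%R = Jminus q m a c.
  by rewrite JminusE //; case: ifP; rewrite ?conjC0 // conjR.
have Kconj m s (a c : 'I_m.+1) : (qJ0 q s%:~R m a c)^*%R = qJ0 q s%:~R m c a.
  rewrite !qJ0E // eq_sym; case: eqP => [->|]; rewrite ?conjC0 // conjR.
  by [].
case: (mxtens_indexP k) => a b; case: (mxtens_indexP l) => c d.
rewrite mxE [in RHS]mxE !tensmxE rmorphD !rmorphM /= !JplusE // !Jconj.
by rewrite (Kconj n2 1) (Kconj n1 (-1)).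
Qed.

(** $E^rv$ has no coordinates with $a+b<r$, because each application of [E] moves the support up by
    one. *)
Lemma Jplus12_nilpotent : E ^+ (n1 + n2).+1 = 0.
Proof.
apply: mulmx_eq0 => v; apply: coord_ext => a b an bn; rewrite /(coord 0).
suff H r : (a + b < r)%N -> coord (E ^+ r *m v) a b = 0.
  by rewrite H ?ltnS ?leq_add // mxE if_same.
elim: r a b an bn => // r IHr a b an bn abr.
rewrite exprS_mulmx coord_Jplus12 //.
have -> : A1 a * P b * coord (E ^+ r *m v) a.-1 b = 0.
  case: a an abr => [|a] an abr; first by rewrite ladder0 !mul0r.
  by rewrite IHr ?mulr0 //= ltnW.
case: b bn abr => [|b] bn abr; first by rewrite ladder0 mulr0 mul0r addr0.
by rewrite IHr ?mulr0 ?addr0 //=; lia.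
Qed.

Hypothesis q_gt0 : 0 < q.
Hypothesis q_neq1 : q != 1.

(** The mixed terms at $(a-1,b+1)$ and $(a+1,b-1)$ agree in both products and cancel. The diagonal
    terms leave $q^{2m_2}[2m_1]+q^{-2m_1}[2m_2]$, which is $[2m_1+2m_2]$ by [qintD]. *)
Lemma commutator_Jplus12_Jminus12 w v : has_weight w v ->
  E *m (F *m v) = F *m (E *m v) + qint q w *: v.
Proof.
move=> wv; apply: coord_ext => a b an bn.
rewrite [LHS](coord_Jplus12 (F *m v) an bn) [RHS]coordD.
rewrite [X in _ = X + _](coord_Jminus12 (E *m v) an bn) [X in _ = _ + X]coordZ.
have -> : qint q w * coord v a b = qint q (twom n1 a + twom n2 b) * coord v a b.
  have [->|/wv <-] := eqVneq (coord v a b) 0; first by rewrite !mulr0.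
  by congr (qint _ _ * _); rewrite /twom; lia.
rewrite qintD // -!ladder_diff //.
have t_neq0 := qpow_neq0 q_gt0 2.
(* The four products are expanded in turn; where an index leaves its range, the ladder coefficient
   in front is zero. *)
have -> : A1 a * P b * coord (F *m v) a.-1 b = A1 a * P b *
    (A1 a * P b * coord v a b + Q a * qpow q 2 * A2 b.+1 * coord v a.-1 b.+1).
  case: a an => [|a] an; first by rewrite ladder0 !mul0r.
  rewrite coord_Jminus12 //= ?(ltnW an) //; congr (_ * (_ + _ * _ * _)).
  by rewrite -qpowD //; congr (qpow _ _); rewrite twomS; lia.
have -> : Q a * A2 b * coord (F *m v) a b.-1 = Q a * A2 b *
    (A1 a.+1 * P b / qpow q 2 * coord v a.+1 b.-1 + Q a * A2 b * coord v a b).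
  case: b bn => [|b] bn; first by rewrite ladder0 !mulr0 !mul0r.
  rewrite coord_Jminus12 //= ?(ltnW bn) // twomS.
  by rewrite qpowD // -[A1 _ * _ / _]mulrA mulfK.
have -> : A1 a.+1 * P b * coord (E *m v) a.+1 b = A1 a.+1 * P b *
    (A1 a.+1 * P b * coord v a b + Q a / qpow q 2 * A2 b * coord v a.+1 b.-1).
  have [->|an1] := eqVneq a n1; first by rewrite ladder_end !mul0r.
  rewrite coord_Jplus12 //=; last by lia.
  have -> : - twom n1 a.+1 = - twom n1 a - 2 by rewrite twomS; lia.
  by rewrite (qpowD q_gt0 (- twom n1 a)) (qpowN q_gt0 2).
have -> : Q a * A2 b.+1 * coord (E *m v) a b.+1 = Q a * A2 b.+1 *
    (A1 a * (P b * qpow q 2) * coord v a.-1 b.+1 + Q a * A2 b.+1 * coord v a b).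
  have [->|bn1] := eqVneq b n2; first by rewrite ladder_end !mulr0 !mul0r.
  rewrite coord_Jplus12 //=; last by lia.
  by rewrite twomS (qpowD q_gt0 (twom n2 b)).
by field.
Qed.

End TensorProduct.

(** * Coupled basis *)

Section Coupling.
Variables (R : realType) (q : R) (n1 n2 n x y z : nat).
Hypothesis q_gt0 : 0 < q.
Hypothesis q_neq1 : q != 1.
Hypothesis n1E : n1 = (x + y)%N.
Hypothesis n2E : n2 = (x + z)%N.
Hypothesis nE : n = (y + z)%N.

Local Notation E := (Jplus12 q n1 n2).
Local Notation F := (Jminus12 q n1 n2).
Local Notation has_weight := (@has_weight R n1 n2).

Definition seed : 'cV[R[i]]_(n1.+1 * n2.+1) :=
  ket n1 (spin R n1) *t ket n2 (spin R n - spin R n1).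

(** The ket with $m_2=j-j_1$ has index $j_2+j-j_1=z$. *)
Lemma coord_seed a b : (a <= n1)%N -> (b <= n2)%N ->
  coord seed a b = ((a == n1) && (b == z))%:R.
Proof.
move=> an bn.
rewrite (coordE seed (Ordinal (an : (a < n1.+1)%N)) (Ordinal (bn : (b < n2.+1)%N))).
rewrite mxE mxtens_indexK !mxE /= -natrM mulnb /mag /spin /=.
congr (_ && _)%:R.
  by rewrite subr_eq -splitr eqr_nat.
rewrite n1E n2E nE !natrD -(eqr_nat R) -subr_eq0 -[RHS]subr_eq0.
by congr (_ == _); field.
Qed.

Lemma has_weight_seed : has_weight n seed.
Proof.
move=> a b; have [/andP[an bn]|/coord_out->] := boolP ((a <= n1)%N && (b <= n2)%N).
  rewrite coord_seed // pnatr_eq0 eqb0 negbK => /andP[/eqP-> /eqP->].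
  by rewrite n1E n2E nE; lia.
by rewrite eqxx.
Qed.

Lemma dot_seed v : dot v seed = (coord v n1 z)^*%R.
Proof.
have zn2 : (z < n2.+1)%N by rewrite n2E ltnS leq_addl.
pose k := mxtens_index (ord_max : 'I_n1.+1, Ordinal zn2).
rewrite /dot (bigD1 k) //= big1 ?addr0 => [|l lk].
  have e := coord_seed (leqnn n1) (zn2 : (z <= n2)%N).
  have entk (w : 'cV[R[i]]_(n1.+1 * n2.+1)) : coord w n1 z = w k 0.
    by rewrite -(coordE w ord_max (Ordinal zn2)).
  by rewrite entk -(entk seed) e !eqxx mulr1.
case: (mxtens_indexP l) lk => a b; rewrite -(coordE seed) coord_seed ?leq_ord //.
move=> lk; case: andP => [[/eqP an /eqP bz]|_]; last by rewrite mulr0.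
case/eqP: lk; congr (mxtens_index (_, _)); exact: val_inj.
Qed.

(* A highest weight vector of weight [n], with coefficient 1 on [seed]: the
   equation [E v = 0] is a two-term recurrence along the weight line. *)
Fixpoint hwcoef (k : nat) : R[i] :=
  if k is k'.+1 then
    let a := (n1 - k')%N in let b := (n1 + z - a).+1 in
    - (qpow q (- twom n1 a) * ladder q n2 b) /
      (ladder q n1 a * qpow q (twom n2 b)) * hwcoef k'
  else 1.

Definition hwvec : 'cV[R[i]]_(n1.+1 * n2.+1) :=
  \col_k (let a := (mxtens_unindex k).1 in let b := (mxtens_unindex k).2 in
    if (a + b == n1 + z)%N then hwcoef (n1 - a) else 0).

Lemma coord_hwvec a b : (a <= n1)%N -> (b <= n2)%N ->
  coord hwvec a b = if (a + b == n1 + z)%N then hwcoef (n1 - a) else 0.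
Proof.
move=> an bn.
rewrite (coordE hwvec (Ordinal (an : (a < n1.+1)%N)) (Ordinal (bn : (b < n2.+1)%N))).
by rewrite mxE mxtens_indexK.
Qed.

Lemma Jplus12_hwvec : E *m hwvec = 0.
Proof.
apply: coord_ext => a b an bn; rewrite [RHS]/coord mxE if_same.
rewrite (coord_Jplus12 q hwvec an bn).
case: a an => [|a] an.
  rewrite ladder0 !mul0r add0r; case: b bn => [|b] bn.
    by rewrite ladder0 mulr0 mul0r.
  rewrite /= (coord_hwvec an (ltnW bn)).
  (* The weight line misses this point, as $b<n_2=x+z\le n_1+z$. *)
  by case: eqP => [|_]; [lia | rewrite mulr0].
case: b bn => [|b] bn.
  rewrite ladder0 mulr0 mul0r addr0 (coord_hwvec (ltnW an) bn) /=.
  by case: eqP => [|_]; [lia | rewrite mulr0].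
rewrite /= (coord_hwvec (ltnW an) bn) (coord_hwvec an (ltnW bn)).
have -> : (a + b.+1 == n1 + z)%N = (a.+1 + b == n1 + z)%N by rewrite addSnnS.
case: eqP => [abE|_]; last by rewrite !mulr0 addr0.
have -> : (n1 - a)%N = (n1 - a.+1).+1 by lia.
rewrite /=; have -> : (n1 - (n1 - a.+1))%N = a.+1 by lia.
have -> : (n1 + z - a.+1)%N = b by lia.
have l_neq0 : ladder q n1 a.+1 != 0 by rewrite ladder_neq0.
have p_neq0 : qpow q (twom n2 b.+1) != 0 by rewrite qpow_neq0.
by field; rewrite l_neq0 p_neq0.
Qed.

Definition proj_seed : 'cV[R[i]]_(n1.+1 * n2.+1) :=
  extremal_proj E F (qint q) n (n1 + n2) seed.

Let qint0' := qint0 q.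
Let qint_gt0' := qint_gt0 q_gt0 q_neq1.
Let qint_rec' := qint_rec q_gt0 q_neq1.
Let adj' := @Jminus12_adj R q n1 n2.
Let weight_raise' := @has_weight_Jplus12 R q n1 n2.
Let weight_lower' := @has_weight_Jminus12 R q n1 n2.
Let comm' := @commutator_Jplus12_Jminus12 R q n1 n2 q_gt0 q_neq1.

Lemma seed_nil : E ^+ (n1 + n2).+1 *m seed = 0.
Proof. by rewrite Jplus12_nilpotent mul0mx. Qed.

Lemma Jplus12_proj_seed : E *m proj_seed = 0.
Proof.
exact: (raise_extremal_proj qint0' qint_gt0' qint_rec' weight_raise'
  weight_lower' comm' has_weight_seed seed_nil).
Qed.

Lemma has_weight_proj_seed : has_weight n proj_seed.
Proof.
exact: (weight_extremal_proj (qint q) weight_raise' weight_lower' (n1 + n2)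
  has_weight_seed (@has_weightD _ _ _) (@has_weightZ _ _ _)).
Qed.

Lemma dot_proj_seed v : E *m v = 0 -> dot v proj_seed = (coord v n1 z)^*%R.
Proof. by move=> Ev; rewrite (dot_extremal_proj qint_gt0' adj' _ _ _ Ev) dot_seed. Qed.

(** Pairing [proj_seed] with [hwvec] returns the seed coefficient of the latter, which is 1, so
    [proj_seed] cannot vanish. *)
Lemma proj_seed_norm_gt0 : 0 < dot proj_seed proj_seed.
Proof.
rewrite lt_neqAle dot_ge0 andbT eq_sym dot_eq0; apply/eqP => hv0.
have := dot_proj_seed Jplus12_hwvec; rewrite hv0 dot0r coord_hwvec //; last by lia.
by rewrite eqxx subnn conjC1 => /eqP; rewrite eq_sym oner_eq0.
Qed.

(** With [proj_seed] itself as test vector in [dot_proj_seed], its seed coefficient is its own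
    squared norm. This fixes the phase. *)
Lemma coord_proj_seed_top : 0 < coord proj_seed n1 z.
Proof.
have := dot_proj_seed Jplus12_proj_seed => /(congr1 Num.conj); rewrite conjCK => <-.
by rewrite -dotC proj_seed_norm_gt0.
Qed.

Lemma qfactorial_qi k : qfactorial (qint q) k = (qfact q k)%:C.
Proof. by rewrite /qfactorial /qfact rmorph_prod. Qed.

Lemma qfact_gt0 k : 0 < qfact q k.
Proof. by rewrite -ltcR -qfactorial_qi qfactorial_gt0. Qed.

(** The prefactor of $P^j_{mj}$. It compensates the norm of $J_-^{j-m}$ on the chain, so that all
    scaled vectors have the norm of [proj_seed]. *)
Definition chain_coef (i : nat) : R[i] :=
  (Num.sqrt (qfact q i / (qfact q n * qfact q (n - i))))%:C.

Lemma chain_coef_gt0 i : 0 < chain_coef i.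
Proof. by rewrite ltcR sqrtr_gt0 divr_gt0 ?mulr_gt0 ?qfact_gt0. Qed.

Lemma chain_coef_sqr i : chain_coef i ^+ 2 =
  qfactorial (qint q) i / (qfactorial (qint q) n * qfactorial (qint q) (n - i)).
Proof.
rewrite -rmorphXn sqr_sqrtr /=; last first.
  by rewrite ltW // divr_gt0 ?mulr_gt0 ?qfact_gt0.
by rewrite fmorph_div rmorphM /= !qfactorial_qi.
Qed.

Lemma chain_coefS i : (i < n)%N -> ladder q n i.+1 * chain_coef i = chain_coef i.+1.
Proof.
move=> lin; apply: (@pexpIrn _ 2) => //; rewrite ?nnegrE ?mulr_ge0 1?ltW ?chain_coef_gt0 //.
  by rewrite ladder_gt0.
rewrite exprMn ladder_sqr ?leqW // !chain_coef_sqr qfactorialS.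
have -> : (n - i)%N = (n - i.+1).+1 by lia.
have -> : n%:Z - i.+1%:Z + 1 = (n - i.+1).+1 by lia.
rewrite qfactorialS; have qfactorial_neq0 := qfactorial_neq0 qint_gt0'.
have /gt_eqF/negbT h := qint_gt0' (n - i.+1).
by field; rewrite h !qfactorial_neq0.
Qed.

(** Up to the prefactor, $P^j_{mj}=J_-^{j-m}P^j_{jj}$. *)
Lemma Pvec_proj_seed (i : 'I_n.+1) :
  Pvec q n1 n2 i = chain_coef i *: (F ^+ (n - i) *m proj_seed).
Proof.
rewrite /Pvec /Pop -scalemxAl; congr (_ *: _).
rewrite -(@fsbig_widen _ _ _ _ `I_(n1 + n2).+1 setT) //; last first.
  (* Nilpotency of $J_+(12)$ cuts the sum over all [r] down to $r\le n_1+n_2$. *)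
  move=> r [_ /negP]; rewrite -leqNgt => nr /=.
  have -> : E ^+ r = 0 by rewrite -(subnKC nr) exprD Jplus12_nilpotent mul0r.
  by rewrite mulmx0 scaler0.
rewrite -fsbig_ord mulmx_suml mulmx_sumr; apply: eq_bigr => r _.
rewrite -scalemxAl -scalemxAr; congr (_ *: _).
  rewrite /proj_coef !qfactorial_qi fmorph_div; congr (_ / _); rewrite rmorphM //.
  by congr (_ * _); rewrite rmorphXn rmorphN1.
by rewrite addnC exprD -mulmxE -!mulmxA.
Qed.

Definition cgvec (i : nat) : 'cV[R[i]]_(n1.+1 * n2.+1) :=
  ((sqrtC (dot proj_seed proj_seed))^-1 * chain_coef i) *: (F ^+ (n - i) *m proj_seed).

Lemma dot_scale_chain i : (i <= n)%N ->
  `|chain_coef i| ^+ 2 *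
    dot (F ^+ (n - i) *m proj_seed) (F ^+ (n - i) *m proj_seed) =
  dot proj_seed proj_seed.
Proof.
move=> lin; rewrite ger0_norm ?(ltW (chain_coef_gt0 i)) // chain_coef_sqr.
rewrite (dot_chain qint0' qint_gt0' qint_rec' adj' weight_lower' comm'
  has_weight_proj_seed Jplus12_proj_seed) ?leq_subr //.
rewrite subKn //; have qfactorial_neq0 := qfactorial_neq0 qint_gt0'.
by field; rewrite !qfactorial_neq0.
Qed.

Lemma dotZZ N c (v : 'cV[R[i]]_N) : dot (c *: v) (c *: v) = `|c| ^+ 2 * dot v v.
Proof.
by rewrite dotZr dotC dotZr rmorphM /= -dotC mulrA normCK.
Qed.

(** The normalizing constant is the same for all [i], by [dot_scale_chain]. *)
Lemma coupled_cgvec (i : 'I_n.+1) : coupled q n1 n2 i = cgvec i.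
Proof.
rewrite /coupled /cgvec Pvec_proj_seed scalerA; congr ((sqrtC _)^-1 * _ *: _).
by rewrite -dot_norm dotZZ dot_scale_chain ?leq_ord.
Qed.

Lemma cgvec_norm i : (i <= n)%N -> dot (cgvec i) (cgvec i) = 1.
Proof.
move=> lin; rewrite dotZZ normrM exprMn -mulrA dot_scale_chain //.
rewrite ger0_norm ?invr_ge0 ?sqrtC_ge0 ?dot_ge0 // exprVn sqrtCK mulVf //.
by rewrite gt_eqF // proj_seed_norm_gt0.
Qed.

Lemma cgvec_weight i : (i <= n)%N -> has_weight (i%:Z *+ 2 - n%:Z) (cgvec i).
Proof.
move=> lin; apply: has_weightZ.
have := weight_lowerX weight_lower' (n - i) has_weight_proj_seed.
by congr has_weight; lia.
Qed.

Lemma cgvec_lower i : (i <= n)%N -> F *m cgvec i = ladder q n i *: cgvec i.-1.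
Proof.
move=> lin; rewrite -scalemxAr -exprS_mulmx.
case: i lin => [|i] lin.
  rewrite subn0 (chain_end qint0' qint_rec' adj' weight_lower' comm'
    has_weight_proj_seed Jplus12_proj_seed).
  by rewrite ladder0 scaler0 scale0r.
rewrite scalerA mulrCA chain_coefS //=; congr (_ *: (F ^+ _ *m _)); lia.
Qed.

Lemma cgvec_raise i : (i <= n)%N -> E *m cgvec i = ladder q n i.+1 *: cgvec i.+1.
Proof.
rewrite leq_eqVlt => /predU1P[->|lin].
  by rewrite -scalemxAr subnn expr0 mul1mx Jplus12_proj_seed ladder_end scale0r scaler0.
rewrite -scalemxAr; have -> : (n - i)%N = (n - i.+1).+1 by lia.
rewrite (raise_chain qint0' qint_rec' weight_lower' comm'
  has_weight_proj_seed Jplus12_proj_seed) !scalerA.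
congr (_ *: _); rewrite -chain_coefS //; set d := _^-1; set l := ladder _ _ _.
(* Expressing [chain_coef i.+1] through [chain_coef i] brings out a second factor [l]; its square is
   the product of $q$-integers from [raise_chain]. *)
have -> : l * (d * (l * chain_coef i)) = d * chain_coef i * l ^+ 2 by ring.
rewrite ladder_sqr ?leqW //; congr (_ * _).
by rewrite mulrC; congr (qint _ _ * qint _ _); lia.
Qed.

Lemma cgvec_top : 0 < coord (cgvec n) n1 z.
Proof.
rewrite coordZ subnn expr0 mul1mx !mulr_gt0 ?chain_coef_gt0 ?coord_proj_seed_top //.
by rewrite invr_gt0 sqrtC_gt0 proj_seed_norm_gt0.
Qed.

End Coupling.

(** * Recurrences and symmetry *)

Section Recurrences.
Variables (R : realType) (q : R) (n1 n2 n x : nat).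
Implicit Type G : nat -> nat -> nat -> R[i].

Local Notation P b := (qpow q (twom n2 b)).
Local Notation Q a := (qpow q (- twom n1 a)).

(** The coordinate along $|j_1m_1\rangle|j_2m_2\rangle$ of the action of $J_-(12)$ on $|jm\rangle$;
    [raising_rec] is the same for $J_+(12)$. *)
Definition lowering_rec G := forall a b i,
  (a <= n1)%N -> (b <= n2)%N -> (i <= n)%N ->
  ladder q n i * G a b i.-1 =
  ladder q n1 a.+1 * P b * G a.+1 b i + Q a * ladder q n2 b.+1 * G a b.+1 i.

Definition raising_rec G := forall a b i,
  (a <= n1)%N -> (b <= n2)%N -> (i <= n)%N ->
  ladder q n i.+1 * G a b i.+1 =
  ladder q n1 a * P b * G a.-1 b i + Q a * ladder q n2 b * G a b.-1 i.

(** The rule $m=m_1+m_2$ in indices, with $x=j_1+j_2-j$. *)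
Definition weight_rule G := forall a b i,
  (a <= n1)%N -> (b <= n2)%N -> (i <= n)%N -> G a b i != 0 -> (a + b = i + x)%N.

Definition cg_like G := [/\ lowering_rec G, raising_rec G & weight_rule G].

Lemma cg_like_lincomb c G H : cg_like G -> cg_like H ->
  cg_like (fun a b i => G a b i - c * H a b i).
Proof.
move=> [lG rG wG] [lH rH wH]; split.
- move=> a b i an bn iin; have e1 := lG a b i an bn iin; have e2 := lH a b i an bn iin.
  rewrite mulrBr [X in X - _]e1 [X in _ - X]mulrCA e2; ring.
- move=> a b i an bn iin; have e1 := rG a b i an bn iin; have e2 := rH a b i an bn iin.
  rewrite mulrBr [X in X - _]e1 [X in _ - X]mulrCA e2; ring.
move=> a b i an bn iin; have [G0|/wG->//] := eqVneq (G a b i) 0.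
have [H0|/wH->//] := eqVneq (H a b i) 0.
by rewrite G0 H0 mulr0 subr0 eqxx.
Qed.

Hypothesis q_gt0 : 0 < q.
Hypothesis q_neq1 : q != 1.

(* The raising relations at the top weight propagate a zero along the
   highest weight vector, the lowering relations from there to all weights. *)
Lemma cg_like_eq0 G z : cg_like G -> (n1 + z = n + x)%N -> G n1 z n = 0 ->
  forall a b i, (a <= n1)%N -> (b <= n2)%N -> (i <= n)%N -> G a b i = 0.
Proof.
move=> [lG rG wG] zE G0.
have top k a b : (a + k = n1)%N -> (b <= n2)%N -> G a b n = 0.
  elim: k a b => [|k IHk] a b.
    rewrite addn0 => -> bn; apply: contra_eq G0 => Gn0.
    have := wG _ _ _ (leqnn _) bn (leqnn _) Gn0 => e.
    by have -> : z = b by lia.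
  move=> ak bn; have an : (a.+1 <= n1)%N by lia.
  have := rG a.+1 b n an bn (leqnn n); rewrite ladder_end mul0r /=.
  rewrite (IHk a.+1 b.-1) ?mulr0 ?addr0; try lia.
  move/esym/eqP; rewrite !mulf_eq0 (negbTE (qpow_neq0 q_gt0 _)).
  by rewrite (negbTE (ladder_neq0 q_gt0 q_neq1 _)) //= => /eqP.
suff H k a b i : (i + k = n)%N -> (a <= n1)%N -> (b <= n2)%N -> G a b i = 0.
  by move=> a b i an bn iin; apply: (H (n - i)%N) => //; lia.
elim: k a b i => [|k IHk] a b i.
  by rewrite addn0 => -> an; apply: (top (n1 - a)%N); lia.
move=> ik an bn; have iin : (i.+1 <= n)%N by lia.
have := lG a b i.+1 an bn iin.
have -> : ladder q n1 a.+1 * P b * G a.+1 b i.+1 = 0.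
  have [->|a1] := eqVneq a n1; first by rewrite ladder_end !mul0r.
  by rewrite IHk ?mulr0 //; lia.
have -> : Q a * ladder q n2 b.+1 * G a b.+1 i.+1 = 0.
  have [->|b1] := eqVneq b n2; first by rewrite ladder_end mulr0 mul0r.
  by rewrite IHk ?mulr0 //; lia.
move/eqP; rewrite addr0 mulf_eq0 (negbTE (ladder_neq0 q_gt0 q_neq1 _)) //=.
by move/eqP.
Qed.

(** On the edge $m_1=j_1$ the lowering relation has a single term on the right, and all coefficients
    are positive. *)
Lemma cg_like_edge_gt0 G z t : cg_like G -> 0 < G n1 z n ->
  (t <= z)%N -> (z <= n2)%N -> (t <= n)%N -> 0 < G n1 (z - t)%N (n - t)%N.
Proof.
move=> [lG rG wG] G0; elim: t => [|t IHt] tz zn2 tn; first by rewrite !subn0.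
have zt : (z - t)%N = (z - t.+1).+1 by lia.
have nt : (n - t)%N = (n - t.+1).+1 by lia.
have := lG n1 (z - t.+1)%N (n - t)%N (leqnn _); rewrite ladder_end !mul0r add0r.
rewrite -zt {3}nt /= => e.
rewrite -(pmulr_rgt0 _ (ladder_gt0 q_gt0 q_neq1 (_ : 0 < n - t <= n)%N)); last by lia.
rewrite e; try lia.
by rewrite !mulr_gt0 ?qpow_gt0 ?ladder_gt0 ?IHt //; lia.
Qed.

(** On the edge $m_2=-j_2$ the raising relation likewise reduces to one term with positive
    coefficient. *)
Lemma cg_like_bottom_gt0 G i t : cg_like G -> 0 < G n1 0 i ->
  (t <= i)%N -> (t <= n1)%N -> (i <= n)%N -> 0 < G (n1 - t)%N 0 (i - t)%N.
Proof.
move=> [lG rG wG] G0; elim: t => [|t IHt] ti tn1 iin; first by rewrite !subn0.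
have n1t : (n1 - t)%N = (n1 - t.+1).+1 by lia.
have it : (i - t)%N = (i - t.+1).+1 by lia.
have := rG (n1 - t)%N 0 (i - t.+1)%N; rewrite ladder0 mulr0 mul0r addr0.
rewrite -it {4}n1t /= => e.
have pos : 0 < ladder q n1 (n1 - t) * P 0.
  by rewrite mulr_gt0 ?qpow_gt0 ?ladder_gt0 //; lia.
rewrite -(pmulr_rgt0 _ pos) -e; try lia.
by rewrite mulr_gt0 ?ladder_gt0 ?IHt //; lia.
Qed.

End Recurrences.

Definition cg (R : realType) (q : R) (n1 n2 n a b i : nat) : R[i] :=
  coord (cgvec q n1 n2 n i) a b.

Lemma CG_cg (R : realType) (q : R) n1 n2 n x y z
    (i1 : 'I_n1.+1) (i2 : 'I_n2.+1) (i : 'I_n.+1) :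
  0 < q -> q != 1 -> n1 = (x + y)%N -> n2 = (x + z)%N -> n = (y + z)%N ->
  CG q i1 i2 i = cg q n1 n2 n i1 i2 i.
Proof.
by move=> q0 q1 e1 e2 e; rewrite /CG (coupled_cgvec q0 q1 e1 e2 e) /cg coordE.
Qed.

(** * Recurrences and norms of the Clebsch-Gordan coefficients *)

Section CGRecurrences.
Variables (R : realType) (q : R) (n1 n2 n x y z : nat).
Hypothesis q_gt0 : 0 < q.
Hypothesis q_neq1 : q != 1.
Hypothesis n1E : n1 = (x + y)%N.
Hypothesis n2E : n2 = (x + z)%N.
Hypothesis nE : n = (y + z)%N.

Lemma cg_cg_like : cg_like q n1 n2 n x (cg q n1 n2 n).
Proof.
split=> a b i an bn iin; rewrite /cg.
- by rewrite -coordZ -(cgvec_lower q_gt0 q_neq1 n1E n2E nE) // coord_Jminus12.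
- by rewrite -coordZ -(cgvec_raise q_gt0 q_neq1 n1E n2E nE) // coord_Jplus12.
by move/(cgvec_weight q_gt0 q_neq1 n1E n2E nE iin); lia.
Qed.

Lemma cg_norm i : (i <= n)%N ->
  \sum_(a < n1.+1) \sum_(b < n2.+1) `|cg q n1 n2 n a b i| ^+ 2 = 1.
Proof.
move=> iin; rewrite -(cgvec_norm q_gt0 q_neq1 n1E n2E nE iin) dot_norm sum_mxtens.
by apply: eq_bigr => a _; apply: eq_bigr => b _; rewrite /cg coordE.
Qed.

Lemma cg_top_gt0 : 0 < cg q n1 n2 n n1 z n.
Proof. exact: (cgvec_top q_gt0 q_neq1 n1E n2E nE). Qed.

End CGRecurrences.

Lemma sum_qpow_sqr (R : realType) (q : R) n : 0 < q -> q != 1 ->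
  \sum_(i < n.+1) qpow q (twom n i) ^+ 2 = qint q n.+1.
Proof.
move=> q0 q1; rewrite /qint -pmulrn -sum_powR_qnum // rmorph_sum /=.
apply: eq_bigr => i _; rewrite -rmorphXn /= expr2 -powRDgt // -splitr.
by rewrite /twom intrD mulrNz mulr2n intrD.
Qed.

(** * Comparison with the reflected coefficients *)

Section Symmetry.
Variables (R : realType) (q : R) (n1 n2 n x y z : nat).
Hypothesis q_gt0 : 0 < q.
Hypothesis q_neq1 : q != 1.
Hypothesis n1E : n1 = (x + y)%N.
Hypothesis n2E : n2 = (x + z)%N.
Hypothesis nE : n = (y + z)%N.

Let qV_gt0 : 0 < q^-1. Proof. by rewrite invr_gt0. Qed.
Let qV_neq1 : q^-1 != 1. Proof. by rewrite invr_eq1. Qed.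
(** Exchanging $j_1$ and $j$ exchanges $x$ and $z$. *)
Let eA : n = (z + y)%N. Proof. by rewrite nE addnC. Qed.
Let eB : n2 = (z + x)%N. Proof. by rewrite n2E addnC. Qed.
Let eC : n1 = (y + x)%N. Proof. by rewrite n1E addnC. Qed.

Definition symfactor : R[i] :=
  (Num.sqrt (qnum q n.+1%:R / qnum q n1.+1%:R))%:C.

Definition cg_sym (a b i : nat) : R[i] :=
  (-1) ^+ b * qpow q (- twom n2 b) * symfactor *
  cg q^-1 n n2 n1 (n - i)%N b (n1 - a)%N.

Lemma ladderV m k : ladder q^-1 m k = ladder q m k.
Proof. by rewrite /ladder !qnum_inv. Qed.

Lemma qpowV w : qpow q^-1 w = qpow q (- w).
Proof. by rewrite /qpow powRinv // mulrNz mulNr. Qed.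

Lemma cg_sym_cg_like : cg_like q n1 n2 n x cg_sym.
Proof.
have [lo ra wg] := cg_cg_like qV_gt0 qV_neq1 eA eB eC.
pose c' := cg q^-1 n n2 n1.
have PB b : qpow q (twom n2 b) * qpow q (- twom n2 b) = 1.
  by rewrite -qpowD // subrr qpow0.
(* On the support $m=m_1+m_2$, so $q^{-m}$ coming from base $1/q$ splits as $q^{-m_1}q^{-m_2}$. *)
have WQ a b i : (a <= n1)%N -> (b <= n2)%N -> (i <= n)%N ->
    qpow q (- - twom n (n - i)) * c' (n - i)%N b (n1 - a)%N =
    qpow q (- twom n1 a) * qpow q (- twom n2 b) * c' (n - i)%N b (n1 - a)%N.
  move=> an bn iin; have [->|c0] := eqVneq (c' (n - i)%N b (n1 - a)%N) 0.
    by rewrite !mulr0.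
  rewrite -qpowD //; congr (qpow q _ * _).
  have := wg _ _ _ (leq_subr i n) bn (leq_subr a n1) c0.
  by rewrite /twom; lia.
split=> a b i an bn iin; rewrite /cg_sym -/c'.
- have := lo (n - i)%N b (n1 - a)%N (leq_subr _ _) bn (leq_subr _ _).
  rewrite !ladderV !qpowV ladder_rev // -subnS -/c'.
  set X := c' _ _ (n1 - a.+1)%N; set Y := c' (n - i).+1 b _.
  set L1 := ladder q n1 a.+1; set L2 := ladder q n2 b.+1.
  set W := qpow q (- - _); set Z := c' _ b.+1 _ => e.
  have h1 : ladder q n i * c' (n - i.-1)%N b (n1 - a)%N =
      ladder q n (n - i).+1 * Y.
    have -> : ladder q n (n - i).+1 = ladder q n i.
      by rewrite -ladder_rev ?leq_subr // subKn.
    have [i0|i_gt0] := posnP i.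
      have -> : ladder q n i = 0 by rewrite i0 ladder0.
      by rewrite [LHS]mul0r [RHS]mul0r.
    by congr (_ * c' _ _ _); lia.
  have h2 : L2 * (W * Z) = L2 * (qpow q (- twom n1 a) * qpow q (- twom n2 b.+1) * Z).
    have [bE|b1] := eqVneq b n2; first by rewrite /L2 bE ladder_end !mul0r.
    by rewrite /W /Z WQ //; lia.
  transitivity ((-1) ^+ b * symfactor * qpow q (- twom n2 b) *
    (ladder q n i * c' (n - i.-1)%N b (n1 - a)%N)); first by ring.
  rewrite h1.
  transitivity ((-1) ^+ b * symfactor *
    (ladder q n (n - i).+1 * qpow q (- twom n2 b) * Y)); first by ring.
  have -> : ladder q n (n - i).+1 * qpow q (- twom n2 b) * Y =
    L1 * X - L2 * (W * Z) by rewrite e; ring.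
  rewrite h2 mulrBr -[X in X - _]mul1r -[X in X * _ - _](PB b) exprS; ring.
- have := ra (n - i)%N b (n1 - a)%N (leq_subr _ _) bn (leq_subr _ _).
  rewrite !ladderV !qpowV (ladder_rev _ iin) -subnS -/c'.
  set X := c' _ _ (n1 - a).+1; set Y := c' (n - i.+1)%N b _.
  set L2 := ladder q n2 b.
  set W := qpow q (- - _); set Z := c' _ b.-1 _ => e.
  have h1 : ladder q n1 a * c' (n - i)%N b (n1 - a.-1)%N =
      ladder q n1 (n1 - a).+1 * X.
    have -> : ladder q n1 (n1 - a).+1 = ladder q n1 a.
      by rewrite -ladder_rev ?leq_subr // subKn.
    have [a0|a_gt0] := posnP a.
      have -> : ladder q n1 a = 0 by rewrite a0 ladder0.
      by rewrite [LHS]mul0r [RHS]mul0r.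
    by congr (_ * c' _ _ _); lia.
  (* Lowering $m_2$ by one flips the sign $(-1)^b$, which allows this term to change sides. *)
  have h2 : (-1) ^+ b * (L2 * (W * Z)) =
      - (L2 * ((-1) ^+ b.-1 * qpow q (- twom n1 a) * qpow q (- twom n2 b.-1) * Z)).
    rewrite /W /Z WQ //; last by lia.
    rewrite /L2; case: (b) => [|k]; first by rewrite ladder0 !mul0r mulr0 oppr0.
    by rewrite /= exprS; ring.
  transitivity ((-1) ^+ b * symfactor *
    (ladder q n i.+1 * qpow q (- twom n2 b) * Y)); first by ring.
  have -> : ladder q n i.+1 * qpow q (- twom n2 b) * Y =
    ladder q n1 a * c' (n - i)%N b (n1 - a.-1)%N - L2 * (W * Z).
    by rewrite h1 e; ring.
  rewrite mulrBr -[X in X - _]mul1r -[X in X * _ - _](PB b).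
  have -> : (-1) ^+ b * symfactor * (L2 * (W * Z)) =
    symfactor * ((-1) ^+ b * (L2 * (W * Z))) by ring.
  rewrite h2; ring.
have := wg (n - i)%N b (n1 - a)%N (leq_subr _ _) bn (leq_subr _ _).
by rewrite mulf_eq0 negb_or => H /andP[_ /H]; lia.
Qed.

Lemma cg_sym_scalar : exists2 lam : R[i], 0 < lam &
  forall a b i, (a <= n1)%N -> (b <= n2)%N -> (i <= n)%N ->
    cg_sym a b i = lam * cg q n1 n2 n a b i.
Proof.
have like := cg_cg_like q_gt0 q_neq1 n1E n2E nE.
have top := cg_top_gt0 q_gt0 q_neq1 n1E n2E nE.
(* With this ratio the combination [cg_sym - lam * cg] vanishes at the top entry, so [cg_like_eq0]
   makes it vanish throughout. *)
pose lam := cg_sym n1 z n / cg q n1 n2 n n1 z n.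
have eqlam a b i : (a <= n1)%N -> (b <= n2)%N -> (i <= n)%N ->
    cg_sym a b i = lam * cg q n1 n2 n a b i.
  move=> an bn iin; apply/eqP; rewrite -subr_eq0; apply/eqP.
  have lc := cg_like_lincomb lam cg_sym_cg_like like.
  apply: (cg_like_eq0 q_gt0 q_neq1 lc (z := z)) => //.
    lia.
  by rewrite divfK ?subrr // gt_eqF.
exists lam => //.
(* At the corner $m_1=j_1$, $m_2=-j_2$ the index of $m$ is $j+j_1-j_2=y$. *)
have c1 : 0 < cg q n1 n2 n n1 0 y.
  have := cg_like_edge_gt0 q_gt0 q_neq1 like top (leqnn z).
  rewrite subnn; have -> : (n - z)%N = y by lia.
  by apply; lia.
have like' := cg_cg_like qV_gt0 qV_neq1 eA eB eC.
have c2 : 0 < cg q^-1 n n2 n1 n 0 y.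
  have := cg_like_edge_gt0 qV_gt0 qV_neq1 like'
    (cg_top_gt0 qV_gt0 qV_neq1 eA eB eC) (leqnn x).
  rewrite subnn; have -> : (n1 - x)%N = y by lia.
  by apply; lia.
(* The reflection sends that corner to the entry with indices [n - y], 0, 0, reached from [c2] by
   [y] steps along the bottom edge. *)
have c3 : 0 < cg q^-1 n n2 n1 (n - y)%N 0 0.
  have := cg_like_bottom_gt0 qV_gt0 qV_neq1 like' c2 (leqnn y).
  by rewrite subnn; apply; lia.
rewrite -(pmulr_lgt0 _ c1) -eqlam //; last by lia.
rewrite /cg_sym subnn expr0 mul1r !mulr_gt0 ?qpow_gt0 //.
by rewrite ltcR sqrtr_gt0 divr_gt0 ?qnum_gt0 ?ltr0n.
Qed.

Lemma symfactor_sqr : `|symfactor| ^+ 2 * qint q n1.+1 = qint q n.+1.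
Proof.
have n1_gt0 : 0 < qnum q n1.+1%:R by rewrite qnum_gt0 ?ltr0n.
have n_gt0 : 0 < qnum q n.+1%:R by rewrite qnum_gt0 ?ltr0n.
have s_ge0 : 0 <= symfactor by rewrite lecR sqrtr_ge0.
rewrite (ger0_norm s_ge0) -rmorphXn sqr_sqrtr; last first.
  exact: ltW (divr_gt0 n_gt0 n1_gt0).
by rewrite /qint -!pmulrn -rmorphM divfK // gt_eqF.
Qed.

(* Weighting by [q^(2m)] turns [q^(-2 m2)] into [q^(2 m1)], so that the sum of
   all squares can be evaluated with the norms on either side. *)
Lemma cg_sym_norm :
  \sum_(i < n.+1) qpow q (twom n i) ^+ 2 *
    (\sum_(a < n1.+1) \sum_(b < n2.+1) `|cg_sym a b i| ^+ 2) = qint q n.+1.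
Proof.
have [_ _ wg] := cg_cg_like qV_gt0 qV_neq1 eA eB eC.
pose c' (a b i : nat) := `|cg q^-1 n n2 n1 (n - i)%N b (n1 - a)%N| ^+ 2.
transitivity (\sum_(i < n.+1) \sum_(a < n1.+1) \sum_(b < n2.+1)
    `|symfactor| ^+ 2 * (qpow q (twom n1 a) ^+ 2 * c' a b i)).
  apply: eq_bigr => i _; rewrite mulr_sumr; apply: eq_bigr => a _.
  rewrite mulr_sumr; apply: eq_bigr => b _.
  rewrite /cg_sym !normrM normrX normrN1 expr1n mul1r.
  rewrite (ger0_norm (ltW (qpow_gt0 q_gt0 _))) /c'.
  have [->|c0] := eqVneq (cg q^-1 n n2 n1 (n - i)%N b (n1 - a)%N) 0.
    by rewrite normr0 expr0n /= !mulr0 expr0n /= mulr0.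
  have -> : twom n1 a = twom n i - twom n2 b.
    have := wg (n - i)%N b (n1 - a)%N (leq_subr _ _) (leq_ord b) (leq_subr _ _) c0.
    have := leq_ord i; have := leq_ord a; rewrite /twom; lia.
  by rewrite [in RHS](qpowD q_gt0 (twom n i)); ring.
rewrite exchange_big /= -symfactor_sqr -sum_qpow_sqr // mulr_sumr.
apply: eq_bigr => a _.
rewrite (reindex_inj rev_ord_inj) /=.
under eq_bigr do rewrite -mulr_sumr -mulr_sumr.
rewrite -!mulr_sumr; congr (_ * _); rewrite -[RHS]mulr1; congr (_ * _).
rewrite -(cg_norm qV_gt0 qV_neq1 eA eB eC (leq_subr a n1)).
apply: eq_bigr => i _; apply: eq_bigr => b _; rewrite /c' subSS subKn //.
by rewrite -ltnS.
Qed.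

(** Inserting [cg_sym = lam * cg] into the weighted sum gives $\lambda^2[2j+1]=[2j+1]$, and
    positivity selects $\lambda=1$. *)
Lemma cg_symE a b i : (a <= n1)%N -> (b <= n2)%N -> (i <= n)%N ->
  cg q n1 n2 n a b i = cg_sym a b i.
Proof.
have [lam lam_gt0 lamE] := cg_sym_scalar.
suff lam1 : lam = 1 by move=> an bn iin; rewrite lamE // lam1 mul1r.
have := cg_sym_norm.
under eq_bigr => j _.
  rewrite (_ : \sum_(a < n1.+1) _ = lam ^+ 2); last first.
    rewrite -[RHS]mulr1 -(cg_norm q_gt0 q_neq1 n1E n2E nE (leq_ord j)) mulr_sumr.
    apply: eq_bigr => c _; rewrite mulr_sumr; apply: eq_bigr => d _.
    by rewrite lamE ?leq_ord // normrM exprMn (ger0_norm (ltW lam_gt0)).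
  over.
rewrite -mulr_suml sum_qpow_sqr // -[RHS]mulr1.
move/(mulfI (lt0r_neq0 (qint_gt0 q_gt0 q_neq1 n)))/eqP.
rewrite sqrf_eq1 => /orP[/eqP//|/eqP lamN].
by move: lam_gt0; rewrite lamN oppr_gt0 ltr10.
Qed.

End Symmetry.

(** The witnesses are $j_1+j_2-j$, $j_1+j-j_2$ and $j_2+j-j_1$; parity makes the halves exact and
    the triangle inequalities make them natural. *)
Lemma triangleP n1 n2 n : triangle n1 n2 n -> exists x y z : nat,
  [/\ n1 = (x + y)%N, n2 = (x + z)%N & n = (y + z)%N].
Proof.
move=> /andP[/andP[le1 le2] /eqP odd_n].
exists ((n1 + n2 - n)./2), ((n1 + n - n2)./2), ((n2 + n - n1)./2).
split; lia.
Qed.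

(* The exponent j2 + m2 of the sign is the natural number i2. *)
Theorem mainTheorem4 (R : realType) (q : R) (n1 n2 n : nat)
    (i1 : 'I_n1.+1) (i2 : 'I_n2.+1) (i : 'I_n.+1)
    (hq : 0 < q < 1)
    (hj : triangle n1 n2 n)
    (hm : mag R i = mag R i1 + mag R i2) :
  CG q i1 i2 i =
    ((-1) ^+ i2 * q `^ (- mag R i2) *
     Num.sqrt (qnum q (2 * spin R n + 1) / qnum q (2 * spin R n1 + 1)))%:C
    * CG q^-1 (rev_ord i) i2 (rev_ord i1).
Proof.
case/andP: hq => q_gt0 q_lt1; have q_neq1 : q != 1 by rewrite lt_eqF.
have [x [y [z [n1E n2E nE]]]] := triangleP hj.
rewrite (CG_cg _ _ _ q_gt0 q_neq1 n1E n2E nE).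
rewrite (@CG_cg _ _ _ _ _ z y x) ?invr_gt0 ?invr_eq1 //; try lia.
rewrite (cg_symE q_gt0 q_neq1 n1E n2E nE) ?leq_ord // /cg_sym /= !subSS.
congr (_ * _); rewrite !rmorphM rmorphXn rmorphN1; congr (_ * _ * _).
  rewrite /qpow /mag /spin /twom; congr (q `^ _)%:C.
  by rewrite mulrNz intrD mulrNz mulr2n intrD -!pmulrn; field.
rewrite /symfactor /spin; congr (Num.sqrt (qnum _ _ / qnum _ _))%:C.
  by rewrite mulrC divfK ?pnatr_eq0 // natr1.
by rewrite mulrC divfK ?pnatr_eq0 // natr1.
Qed.
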